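(* Let $x^*$ be a local minimizer of the problem $\min_{x\in\mathbb{R}^n} f(x)$ subject to $h(x)=0$, $x\in\mathbb{S}$. Let $\Gamma^*=\mathrm{supp}(x^* )$ and suppose that $\mathrm{rank}(\nabla_{\Gamma^*}h(x^* ))=m$. Then there exists a unique $y^*\in\mathbb{R}^m$ such that $x^*$ is a strong $\beta$-Lagrangian stationary point of the problem with Lagrangian multiplier $y^*$ for every $\beta\in(0,\hat\beta)$, where, with $q^*:=\nabla_xL(x^*,y^* )$, $$\hat\beta:=\begin{cases}\dfrac{|x^*|_{(s)}}{\|q^*_{(\Gamma^* )^c}\|_\infty}, & \text{if } \|x^*\|_0=s \text{ and } q^*_{(\Gamma^* )^c}\neq 0,\\[2mm] +\infty, & \text{otherwise.}\end{cases}$$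
   Context: Let $n,m,s$ be positive integers with $0<s<n$; $f:\mathbb{R}^n\to\mathbb{R}$ and $h=(h_1,\dots,h_m)^\top:\mathbb{R}^n\to\mathbb{R}^m$ are twice continuously differentiable. $\|x\|_0$ is the number of nonzero components of $x$, and $\mathbb{S}=\{x\in\mathbb{R}^n:\|x\|_0\le s\}$. $\mathrm{supp}(x)=\{i:x_i\ne0\}$; $T^c=\{1,\dots,n\}\setminus T$; $x_T$ is the subvector of $x$ indexed by $T$; $|x|_{(s)}$ is the $s$-th largest absolute value among the components of $x$. $\nabla h(x)\in\mathbb{R}^{m\times n}$ is the Jacobian matrix of $h$ (its rows are $\nabla h_i(x)^\top$), and $\nabla_T h(x)$ is its submatrix of columns indexed by $T$. Lagrangian: $L(x,y)=f(x)-\langle y,h(x)\rangle$, $y\in\mathbb{R}^m$; $\nabla_xL$ is its gradient with respect to $x$. $\Pi_{\mathbb{S}}(z)=\arg\min_{w\in\mathbb{S}}\|z-w\|^2$ (in general a set). Definition: for $\beta>0$, $x^*\in\mathbb{R}^n$ is a strong $\beta$-Lagrangian stationary point of the problem with Lagrangian multiplier $y^*\in\mathbb{R}^m$ if $x^*=\Pi_{\mathbb{S}}(x^*-\beta\nabla_xL(x^*,y^* ))$ and $h(x^* )=0$. The equality with $\Pi_{\mathbb{S}}$ means that the projection set is the singleton $\{x^*\}$. *)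

(* Defs.v *)
From HB Require Import structures.
From mathcomp Require Import all_boot all_order all_algebra.
From mathcomp Require Import all_classical all_reals all_analysis.

Set Implicit Arguments.
Unset Strict Implicit.
Unset Printing Implicit Defensive.

Import Order.TTheory GRing.Theory Num.Theory.
Import numFieldNormedType.Exports.

Local Open Scope classical_set_scope.
Local Open Scope ring_scope.

(* Vectors of R^n are row vectors 'rV[R]_n.  On matrices the norm `|A| of
   MathComp-Analysis is the sup norm, hence the Euclidean norm norm2 below; the
   two define the same topology, so nbhs, continuous and differentiable have
   their usual meaning. *)

Section Vectors.
Variables (R : realType) (n : nat).
Implicit Types (x z : 'rV[R]_n) (T : {set 'I_n}).

Definition dotp x z : R := \sum_(i < n) x 0 i * z 0 i.

Definition norm2 x : R := Num.sqrt (dotp x x).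

Definition supp x : {set 'I_n} := [set i | x 0 i != 0]%SET.

Definition norm0 x : nat := #|supp x|.

(* Columns of A indexed by T, in increasing order; for a row vector this is
   the subvector x_T. *)
Definition subcols p T (A : 'M[R]_(p, n)) : 'M[R]_(p, #|T|) :=
  colsub (fun k : 'I_#|T| => enum_val k) A.

(* |x|_(s), for 1 <= s <= n: the entries are counted with multiplicity and
   nth starts from 0. *)
Definition abs_nth_largest (s : nat) x : R :=
  nth 0 (sort (fun a b : R => b <= a) [seq `|x 0 i| | i <- enum 'I_n]) s.-1.

Definition sparse (s : nat) : set 'rV[R]_n := [set x | (norm0 x <= s)%N].

End Vectors.

Section Optimization.
Variables (R : realType) (n : nat).

Definition argmin (phi : 'rV[R]_n -> R) (A : set 'rV[R]_n) : set 'rV[R]_n :=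
  [set w | A w /\ forall v, A v -> phi w <= phi v].

Definition local_minimizer (phi : 'rV[R]_n -> R) (A : set 'rV[R]_n)
    (x : 'rV[R]_n) : Prop :=
  A x /\ \forall z \near x, A z -> phi x <= phi z.

Definition sparse_proj (s : nat) (z : 'rV[R]_n) : set 'rV[R]_n :=
  argmin (fun w => norm2 (z - w) ^+ 2) (@sparse R n s).

End Optimization.

Section Calculus.
Variables (R : realType) (n m : nat).
Implicit Types (f : 'rV[R]_n -> R) (h : 'rV[R]_n -> 'rV[R]_m).

Definition gradient f (x : 'rV[R]_n) : 'rV[R]_n :=
  \row_(i < n) 'D_(delta_mx 0 i) f x.

(* The library's 'J h x acts on row vectors from the right and is n x m; its
   transpose is the usual m x n Jacobian matrix, whose rows are the gradients
   of the components of h. *)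
Definition jacobian_mx h (x : 'rV[R]_n) : 'M[R]_(m, n) := ('J h x)^T.

Definition continuously_differentiable h : Prop :=
  (forall x, differentiable h x) /\ continuous (jacobian_mx h).

End Calculus.

Section Problem.
Variables (R : realType) (n m : nat).
Variables (f : 'rV[R]_n -> R) (h : 'rV[R]_n -> 'rV[R]_m).

Definition twice_continuously_differentiable (g : 'rV[R]_n -> R) : Prop :=
  (forall x, differentiable g x) /\ continuously_differentiable (gradient g).

Definition feasible (s : nat) : set 'rV[R]_n :=
  [set x | h x = 0 /\ sparse s x].

Definition lagrangian (x : 'rV[R]_n) (y : 'rV[R]_m) : R := f x - dotp y (h x).

Definition grad_lagrangian (x : 'rV[R]_n) (y : 'rV[R]_m) : 'rV[R]_n :=
  gradient (fun z => lagrangian z y) x.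

Definition strong_stationary (s : nat) (beta : R) (x : 'rV[R]_n)
    (y : 'rV[R]_m) : Prop :=
  sparse_proj s (x - beta *: grad_lagrangian x y) = [set x] /\ h x = 0.

Definition beta_hat (s : nat) (x : 'rV[R]_n) (y : 'rV[R]_m) : \bar R :=
  let q := subcols (~: supp x)%SET (grad_lagrangian x y) in
  if (norm0 x == s) && (q != 0) then (abs_nth_largest s x / `|q|)%:E
  else +oo%E.

End Problem.

(* Main.v *)
(* Lagrange multipliers by penalization (McShane). Let T contain the support of
   x^* with |T| <= s, so that x^* minimizes f locally on {h = 0, supp x in T}.
   Minimizing f + |x - x^*|^2 + k |h|^2 over a small ball of R^T, for k large,
   gives points x arbitrarily close to x^* at which the gradient of
   f + |x - x^*|^2 is, on T, a combination y of the gradients of h. A right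
   inverse P of the Jacobian at x^* supported on supp x^* eliminates y through
   a polynomial identity, which passes to the limit: on T, the gradient of f is
   y^* times the Jacobian, with y^* = (grad f) P. As y^* does not depend on T,
   q^* vanishes on supp x^*, and everywhere if |supp x^*| < s (add any index to
   the support). The projection is then computed entry by entry. Conversely a
   stationary point has q = 0 on supp x^*, which forces y = (grad f) P. *)

Require Import Defs.
From mathcomp Require Import all_boot all_order all_algebra.
From mathcomp Require Import all_classical all_reals all_analysis.
From mathcomp Require Import ring lra.
Import Order.TTheory GRing.Theory Num.Theory.
Import numFieldNormedType.Exports.
Local Open Scope ring_scope.

Set Implicit Arguments.
Unset Strict Implicit.

Section Analysis.
Local Open Scope classical_set_scope.

(** * Calculus of real functions: sums, squares, level sets, minima along a line *)

Section Sums.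
Variables (R : realType) (V : normedModType R).

Lemma differentiable_bigsum (W : normedModType R) p (F : 'I_p -> V -> W) x :
  (forall i, differentiable (F i) x) ->
  differentiable (fun z => \sum_(i < p) F i z) x.
Proof.
move=> dF; rewrite (_ : (fun z => _) = \sum_(i < p) F i).
  exact: differentiable_sum.
by apply/funext => z; rewrite fct_sumE.
Qed.

Lemma derive_bigsum (W : normedModType R) p (F : 'I_p -> V -> W) x v :
  (forall i, differentiable (F i) x) ->
  'D_v (fun z => \sum_(i < p) F i z) x = \sum_(i < p) 'D_v (F i) x.
Proof.
move=> dF; rewrite (_ : (fun z => _) = \sum_(i < p) F i).
  by rewrite derive_sum // => i; apply: diff_derivable.
by apply/funext => z; rewrite fct_sumE.
Qed.

Lemma differentiable_sqr (F : V -> R) x :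
  differentiable F x -> differentiable (fun z => F z ^+ 2) x.
Proof. by move=> dF; rewrite (_ : (fun z => _) = F ^+ 2) //; exact: differentiableX. Qed.

Lemma derive_sqr (F : V -> R) x v : differentiable F x ->
  'D_v (fun z => F z ^+ 2) x = 2 * F x * 'D_v F x.
Proof.
move=> dF; have dFv : derivable F x v by exact: diff_derivable.
by rewrite (_ : (fun z => _) = F ^+ 2) ?deriveX.
Qed.

End Sums.

Section Closed.
Variables (R : realType) (T : topologicalType) (F : T -> R).
Hypothesis cF : continuous F.

Lemma closed_level_le r : closed [set x | F x <= r].
Proof.
rewrite -[mkset _]/(F @^-1` [set r' | r' <= r]).
by apply: preimage_closed => [x _|]; [exact: cF|exact: closed_le].
Qed.

Lemma closed_level_eq r : closed [set x | F x = r].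
Proof.
rewrite -[mkset _]/(F @^-1` [set r' | r' = r]).
by apply: preimage_closed => [x _|]; [exact: cF|exact: closed_eq].
Qed.
End Closed.

Section Line.
Variables (R : realType) (n : nat).

(** The directional derivative is the derivative at 0 of the one-variable restriction [phi], which
    has an interior minimum there. *)
Lemma derive_line_min (F : 'rV[R]_n -> R) x v d :
    (forall z, differentiable F z) -> 0 < d ->
    (forall t, `|t| < d -> F x <= F (t *: v + x)) ->
  'D_v F x = 0.
Proof.
move=> dF d_gt0 F_min; pose phi t := F (t *: v + x).
suff phi0 : is_derive (0 : R) 1 phi 0.
  case: phi0 => _ <-.
  rewrite /derive /phi scale0r add0r; apply: (congr1 (fun g : R -> R => lim (g @ 0^'))).
  by apply/funext => t /=; rewrite addr0 [_%:A]mulr1.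
apply: (@derive1_at_min _ phi (- d) d); first by lra.
- move=> t _; apply: diff_derivable.
  rewrite (_ : phi = F \o (fun t => t *: v + x)) //.
  by apply: differentiable_comp.
- by rewrite in_itv /=; apply/andP; lra.
- move=> t; rewrite in_itv /= -ltr_norml => /F_min.
  by rewrite /phi scale0r add0r.
Qed.
End Line.

Lemma derive_coordB (R : realType) n (x v xs : 'rV[R]_n) j :
  'D_v (fun z : 'rV[R]_n => z 0 j - xs 0 j) x = v 0 j.
Proof.
have dj : derivable (fun z : 'rV[R]_n => z 0 j) x v.
  by apply: diff_derivable; exact: differentiable_coord.
rewrite (_ : (fun z => _) = (fun z : 'rV[R]_n => z 0 j) - cst (xs 0 j)) //.
rewrite deriveB // derive_cst subr0.
have := @derive_mx R 'rV[R]_n 1 n id x v (@derivable_id _ _ x v).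
by rewrite derive_id => /rowP/(_ j); rewrite mxE.
Qed.

(** * Approximate multipliers by quadratic penalization *)

Section Penalty.
Variables (R : realType) (n m : nat).
Variables (f : 'rV[R]_n -> R) (c : 'I_m -> 'rV[R]_n -> R).
Hypothesis df : forall x, differentiable f x.
Hypothesis dc : forall k x, differentiable (c k) x.

Let cont_of_diff (F : 'rV[R]_n -> R) :
  (forall x, differentiable F x) -> continuous F.
Proof. by move=> dF x; apply: differentiable_continuous. Qed.

(** The squared distance to [xs] makes [xs] a strict minimizer among the feasible points of the
    ball. For a large penalty the minimum over the ball therefore avoids the sphere, and the
    derivatives along the directions of [T] vanish there. *)
Lemma penalty_stationary (T : {set 'I_n}) (xs : 'rV[R]_n) e :
    0 < e -> supp xs \subset T -> (forall k, c k xs = 0) ->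
    (forall z, `|z - xs| <= e -> supp z \subset T -> (forall k, c k z = 0) ->
      f xs <= f z) ->
  exists x y, `|x - xs| < e /\ forall i, i \in T ->
    'D_(delta_mx 0 i) f x + 2 * (x - xs) 0 i
    = \sum_(k < m) y k * 'D_(delta_mx 0 i) (c k) x.
Proof.
move=> e_gt0 sxs cxs f_min.
pose F0 x := f x + \sum_(i < n) (x 0 i - xs 0 i) ^+ 2.
pose H x := \sum_(k < m) c k x ^+ 2.
have dcoord j x : differentiable (fun x : 'rV[R]_n => x 0 j - xs 0 j) x.
  by apply: differentiableB => //; exact: differentiable_coord.
have dsq x : differentiable (fun x : 'rV[R]_n => \sum_(i < n) (x 0 i - xs 0 i) ^+ 2) x.
  by apply: differentiable_bigsum => i; apply: differentiable_sqr.
have dF0 x : differentiable F0 x by apply: differentiableD.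
have dH x : differentiable H x.
  by apply: differentiable_bigsum => i; apply: differentiable_sqr.
have H_ge0 x : 0 <= H x by apply: sumr_ge0 => k _; exact: sqr_ge0.
have suppP (z : 'rV[R]_n) : supp z \subset T <-> forall i, i \notin T -> z 0 i = 0.
  split=> [/fintype.subsetP sz i|z0].
    by apply: contraNeq => zi; apply: sz; rewrite inE.
  by apply/fintype.subsetP => i; rewrite inE; apply: contraNT => /z0 ->.
pose B := [set x : 'rV[R]_n | `|x - xs| <= e] `&` [set x | supp x \subset T].
have csub x : {for x, continuous (fun z : 'rV[R]_n => z - xs)}.
  have : differentiable (fun z : 'rV[R]_n => z - xs) x by exact: differentiableB.
  by move/differentiable_continuous.
have cdist : continuous (fun x : 'rV[R]_n => `|x - xs|).
  by move=> x; exact: (cvg_norm (csub x)).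
have clB : closed B.
  apply: closedI; first exact: closed_level_le.
  rewrite (_ : [set x | _] = \bigcap_(i in [set i | i \notin T]) [set x : 'rV[R]_n | x 0 i = 0]).
    by apply: closed_bigI => i _; apply: closed_level_eq; exact: coord_continuous.
  by apply/seteqP; split => z /= /suppP.
have bB : bounded_set B.
  exists (e + `|xs|); split; first exact: num_real.
  move=> M M_gt x [/= xB _]; rewrite (le_trans _ (ltW M_gt)) //.
  by rewrite -{1}[x](subrK xs) (le_trans (ler_normD _ _)) // lerD2r.
have cB : compact B by exact: bounded_closed_compact.
have Bxs : B xs by split => //=; rewrite subrr normr0 ltW.
have [k k_ge0 Fk_gt] : exists2 k, 0 <= k &
    forall x, B x -> `|x - xs| = e -> f xs < F0 x + k * H x.
  (* Only the points of the sphere where [F0] does not already exceed [f xs] need the penalty. They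
     form a compact set, on which [H] and [F0] attain their minima, at [a] and [b]. *)
  pose K := B `&` ([set x | `|x - xs| = e] `&` [set x | F0 x <= f xs]).
  have cK : compact K.
    apply: subclosed_compact cB _ => //; last by apply: subIsetl.
    apply: closedI => //; apply: closedI; first exact: closed_level_eq.
    by apply: closed_level_le; exact: cont_of_diff.
  have [[a0 Ka0]|K0] := pselect (K !=set0); last first.
    exists 0 => // x Bx xe; rewrite mul0r addr0 ltNge; apply/negP => F0x.
    by apply: K0; exists x.
  have [a /set_mem Ka a_min] := EVT_min_rV (ex_intro _ _ Ka0) cK
    (continuous_subspaceT (cont_of_diff dH)).
  have [b /set_mem Kb b_min] := EVT_min_rV (ex_intro _ _ Ka0) cK
    (continuous_subspaceT (cont_of_diff dF0)).
  (* If [a] were feasible, then [f xs <= f a < F0 a <= f xs], the strict inequality because [a] lies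
     on the sphere and so differs from [xs]. *)
  have Ha : 0 < H a.
    rewrite lt_neqAle H_ge0 andbT eq_sym; apply/negP => /eqP Ha0.
    have ca k : c k a = 0.
      apply/eqP; rewrite -sqrf_eq0; apply/eqP.
      by apply: (psumr_eq0P _ Ha0) => // j _; exact: sqr_ge0.
    case: Ka => -[/= aB sa] [/= ae F0a].
    have := f_min a aB sa ca; rewrite leNgt => /negP; apply.
    apply: lt_le_trans F0a; rewrite /F0 ltrDl lt_neqAle sumr_ge0 ?andbT; last first.
      by move=> i _; exact: sqr_ge0.
    apply/negP => /eqP/esym sq0.
    have : `|a - xs| = 0.
      rewrite (_ : a = xs) ?subrr ?normr0 //; apply/rowP => i.
      apply/eqP; rewrite -subr_eq0 -sqrf_eq0; apply/eqP.
      by apply: (psumr_eq0P _ sq0) => // j _; exact: sqr_ge0.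
    by rewrite ae => e0; rewrite e0 ltxx in e_gt0.
  have F0b : F0 b <= f xs by case: Kb => _ [].
  (* This value gives [F0 b + k * H a = f xs + H a]; the added 1 makes the inequality strict. *)
  exists ((f xs - F0 b) / H a + 1).
    by rewrite addr_ge0 // divr_ge0 ?subr_ge0.
  move=> x Bx xe; have [F0x|] := leP (F0 x) (f xs); last first.
    move=> /lt_le_trans; apply; rewrite lerDl mulr_ge0 //.
    by rewrite addr_ge0 // divr_ge0 ?subr_ge0.
  have Kx : x \in K by apply/mem_set.
  apply: (@lt_le_trans _ _ (F0 b + ((f xs - F0 b) / H a + 1) * H a)).
    by rewrite mulrDl mul1r divfK ?gt_eqF //; lra.
  apply: lerD; first exact: b_min.
  by apply: ler_wpM2l; [rewrite addr_ge0 // divr_ge0 ?subr_ge0|exact: a_min].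
pose F x := F0 x + k * H x.
have dF x : differentiable F x by apply: differentiableD => //; apply: differentiableZ.
have [x /set_mem Bx x_min] := EVT_min_rV (ex_intro _ _ Bxs) cB
    (continuous_subspaceT (cont_of_diff dF)).
have Fx : F x <= f xs.
  have := x_min xs (mem_set Bxs); rewrite {2}/F /F0 /H.
  rewrite !big1 ?mulr0 ?addr0 // => i _; first by rewrite cxs expr0n.
  by rewrite subrr expr0n.
have xe : `|x - xs| < e.
  rewrite lt_neqAle; apply/andP; split; last by case: Bx.
  by apply/negP => /eqP xe; have := Fk_gt x Bx xe; rewrite ltNge Fx.
(* The derivative of [k * H] is the sum of the [2 * k * c j x] times the derivatives of the [c j];
   moved to the other side, these coefficients are the multipliers. *)
exists x, (fun j => - (2 * k * c j x)); split => // i iT.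
pose v : 'rV[R]_n := delta_mx 0 i.
have v1_gt0 : 0 < `|v| + 1 by rewrite ltr_wpDl.
have : 'D_v F x = 0.
  (* Steps of this size keep [t *: v + x] in the ball; the added 1 makes the denominator positive
     whatever the norm of [v]. *)
  apply: (@derive_line_min _ _ _ _ _ ((e - `|x - xs|) / (`|v| + 1))) => //.
    by rewrite divr_gt0 ?subr_gt0.
  move=> t; rewrite ltr_pdivlMr // => t_lt.
  apply/x_min/mem_set; split => /=.
    rewrite -addrA (le_trans (ler_normD _ _)) // normrZ.
    by have := normr_ge0 t; move: t_lt; rewrite mulrDr mulr1; lra.
  apply/suppP => j jT; rewrite !mxE eqxx /=.
  have /negPf-> : j != i by apply: contraNneq jT => ->.
  by rewrite mulr0 add0r; apply: (suppP x).1 => //; case: Bx.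
rewrite (_ : F = f + ((fun z : 'rV[R]_n => \sum_(i < n) (z 0 i - xs 0 i) ^+ 2) + k *: H)); last first.
  by apply/funext => z; rewrite /F /F0 -addrA.
have dv (g : 'rV[R]_n -> R) : differentiable g x -> derivable g x v.
  exact: diff_derivable.
have dkH : differentiable (k *: H) x by exact: differentiableZ.
rewrite deriveD; [|exact: dv|by apply: dv; exact: differentiableD].
rewrite deriveD; [|exact: dv|exact: dv].
rewrite deriveZ; last exact: dv.
rewrite !derive_bigsum; [|by move=> ?; exact: differentiable_sqr..].
rewrite (bigD1 i) //= big1 => [|j ji]; last first.
  by rewrite derive_sqr // derive_coordB /v mxE eqxx (negPf ji) mulr0.
rewrite derive_sqr // derive_coordB /v mxE !eqxx mulr1 addr0 !mxE addrA.
move/eqP; rewrite addr_eq0 => /eqP ->; rewrite scaler_sumr -sumrN.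
apply: eq_bigr => j _; rewrite derive_sqr // /GRing.scale /=; ring.
Qed.
End Penalty.

(** * Continuity of matrix products, determinants and adjugates *)

Section MatrixContinuity.
Variables (R : realType) (X : topologicalType) (x : X).

(** Continuity is taken entry by entry, so that matrix operations reduce to sums and products of
    real functions. *)
Definition mx_continuous p q (M : X -> 'M[R]_(p, q)) :=
  forall i j, {for x, continuous (fun z => M z i j)}.

Lemma continuous_at_eq (F G : X -> R) :
  F =1 G -> {for x, continuous G} -> {for x, continuous F}.
Proof. by move/funext->. Qed.

Lemma continuous_at_coord p (G : X -> 'rV[R]_p) j :
  {for x, continuous G} -> {for x, continuous (fun z => G z 0 j)}.
Proof. by move=> cG; exact: (continuous_comp cG (@coord_continuous R 1 p 0 j (G x))). Qed.

Lemma mx_continuous_mul p q r (M : X -> 'M[R]_(p, q)) (N : X -> 'M[R]_(q, r)) :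
  mx_continuous M -> mx_continuous N -> mx_continuous (fun z => M z *m N z).
Proof.
move=> cM cN i j; apply: continuous_at_eq (fun z => mxE _ _ _ _) _.
apply: cvg_big => [|k _]; first exact: add_continuous.
by apply: cvgM; [exact: cM|exact: cN].
Qed.

Lemma mx_continuous_scale p q (a : X -> R) (M : X -> 'M[R]_(p, q)) :
  {for x, continuous a} -> mx_continuous M ->
  mx_continuous (fun z => a z *: M z).
Proof.
move=> ca cM i j; apply: continuous_at_eq (fun z => mxE _ _ _ _) _.
by apply: cvgM; [exact: ca|exact: cM].
Qed.

Lemma mx_continuous_det p (M : X -> 'M[R]_p) :
  mx_continuous M -> {for x, continuous (fun z => \det (M z))}.
Proof.
move=> cM; rewrite /continuous_at.
apply: cvg_big => [|s _]; first exact: add_continuous.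
apply: cvgM; first exact: cvg_cst.
apply: cvg_big => [|k _]; first exact: mul_continuous.
exact: cM.
Qed.

Lemma mx_continuous_adj p (M : X -> 'M[R]_p) :
  mx_continuous M -> mx_continuous (fun z => \adj (M z)).
Proof.
move=> cM i j; apply: continuous_at_eq (fun z => mxE _ _ _ _) _.
apply: cvgM; first exact: cvg_cst.
apply: (@mx_continuous_det _ (fun z => row' j (col' i (M z)))) => k l.
apply: (@continuous_at_eq _ (fun z => M z (lift j k) (lift i l))) => [z|].
  by rewrite !mxE.
exact: cM.
Qed.

End MatrixContinuity.

(** * Passage to the limit: the exact multiplier rule *)

Section Multiplier.
Variables (R : realType) (n m : nat).
Variables (f : 'rV[R]_n -> R) (c : 'I_m -> 'rV[R]_n -> R).
Hypothesis df : forall x, differentiable f x.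
Hypothesis dc : forall k x, differentiable (c k) x.
Hypothesis cgf : continuous (gradient f).
Hypothesis cgc : forall k, continuous (gradient (c k)).

Definition gradients x : 'M[R]_(m, n) := \matrix_(k < m) gradient (c k) x.

(** Nothing bounds the multipliers of the approximating points in advance, so no limit of them is
    taken: they are eliminated, and only an identity in the continuous data [g], [gradients] and [P]
    passes to the limit. The adjugate replaces the inverse of [M x]. *)
Lemma lagrange_multiplier (T : {set 'I_n}) (xs : 'rV[R]_n) (P : 'M[R]_(n, m)) :
    supp xs \subset T -> (forall k, c k xs = 0) ->
    (\forall z \near xs, supp z \subset T -> (forall k, c k z = 0) ->
      f xs <= f z) ->
    (forall i k, i \notin T -> P i k = 0) -> gradients xs *m P = 1%:M ->
  forall i, i \in T ->
    gradient f xs 0 i = (gradient f xs *m P *m gradients xs) 0 i.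
Proof.
move=> sxs cxs f_min PT gP1 i iT.
pose g x := gradient f x + 2 *: (x - xs).
pose M x := gradients x *m P.
(* Cramer's rule: where [g = y *m gradients] on [T], the vector [g *m P] is
   [y *m M], whence [G = 0]; being polynomial, [G] also vanishes at [xs]. *)
pose G x := \det (M x) *: g x - g x *m P *m \adj (M x) *m gradients x.
have GE x : G x 0 i = (\det (M x) *: g x) 0 i -
    (g x *m P *m \adj (M x) *m gradients x) 0 i.
  by rewrite [LHS]mxE [X in _ + X]mxE.
have cg : mx_continuous xs g.
  move=> a j.
  apply: (@continuous_at_eq _ _ xs _ (fun z => gradient f z 0 j + 2 * (z 0 j - xs 0 j))) => [z|].
    by rewrite ord1 !mxE.
  have dj : differentiable (2 *: ((fun z : 'rV[R]_n => z 0 j) - cst (xs 0 j))) xs.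
    by apply: differentiableZ; apply: differentiableB => //; exact: differentiable_coord.
  have c1 : {for xs, continuous (fun z => gradient f z 0 j)}.
    exact: (continuous_at_coord (@cgf xs)).
  have c2 : {for xs, continuous (fun z : 'rV[R]_n => 2 * (z 0 j - xs 0 j))}.
    by move/differentiable_continuous: dj.
  exact: (cvgD c1 c2).
have cA : mx_continuous xs gradients.
  move=> k j.
  apply: (@continuous_at_eq _ _ xs _ (fun z => gradient (c k) z 0 j)) => [z|].
    by rewrite mxE.
  exact: (continuous_at_coord (@cgc k xs)).
have cP : mx_continuous xs (fun=> P) by move=> a b; exact: (@cvg_cst _ _ _ _ (nbhs_filter xs)).
have cM : mx_continuous xs M by exact: mx_continuous_mul.
have cG : {for xs, continuous (fun x => G x 0 i)}.
  have c1 : mx_continuous xs (fun x => \det (M x) *: g x).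
    exact: (mx_continuous_scale (mx_continuous_det cM) cg).
  have c2 : mx_continuous xs (fun x => g x *m P *m \adj (M x) *m gradients x).
    have cgPadj := mx_continuous_mul (mx_continuous_mul cg cP) (mx_continuous_adj cM).
    exact: (mx_continuous_mul cgPadj cA).
  apply: continuous_at_eq GE _.
  exact: (cvgB (c1 0 i) (c2 0 i)).
(* At [xs] the matrix [M] is the identity and [g] is the gradient of [f], so this is the claim. *)
suff : G xs 0 i = 0.
  rewrite GE /M gP1 det1 adj1 /g subrr scaler0 addr0 mulmx1 scale1r.
  by move/eqP; rewrite subr_eq0 => /eqP.
apply/eqP; apply: contraT => G_neq0.
have near_neq0 : \forall z \near xs, G z 0 i != 0 by exact: (cvgr_neq0 _ cG G_neq0).
have near_both : \forall z \near xs,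
    (supp z \subset T -> (forall k, c k z = 0) -> f xs <= f z) /\ G z 0 i != 0.
  exact: (filterI f_min near_neq0).
have [e /= e_gt0 near_e] := (nbhs_normP _ _).1 near_both.
(* The radius is halved because the penalization uses a closed ball, whereas [near_e] holds on an
   open one. *)
have he_gt0 : 0 < e / 2 by rewrite divr_gt0.
have [z ze sz cz|x [y [xe y_eq]]] := penalty_stationary df dc he_gt0 sxs cxs.
  apply: (near_e z _).1 => //=; rewrite /ball_/= distrC (le_lt_trans ze) //; lra.
have [_ /eqP[]] : (supp x \subset T -> (forall k, c k x = 0) -> f xs <= f x) /\
    G x 0 i != 0.
  by apply: near_e; rewrite /= /ball_/= distrC (lt_trans xe) //; lra.
pose yv : 'rV[R]_m := \row_k y k.
have g_eq j : j \in T -> g x 0 j = (yv *m gradients x) 0 j.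
  by move=> /y_eq; rewrite !mxE => ->; apply: eq_bigr => k _; rewrite !mxE.
(* The equality [g_eq] holds on [T] only, which suffices since the rows of [P] vanish off [T]. *)
have gP : g x *m P = yv *m M x.
  rewrite /M mulmxA; apply/rowP => k; rewrite !mxE; apply: eq_bigr => j _.
  by have [/g_eq->//|jT] := boolP (j \in T); rewrite PT // !mulr0.
rewrite GE gP -(mulmxA yv) mul_mx_adj mul_mx_scalar -scalemxAl.
by rewrite [X in X - _]mxE [X in _ - X]mxE -g_eq // subrr.
Qed.
End Multiplier.

End Analysis.

(** * The s-th largest absolute value of a vector with s nonzero entries *)

Section AbsNthLargest.
Variables (R : realType) (n : nat).
Implicit Type x : 'rV[R]_n.

(** In a nonincreasing list the positive entries form an initial segment. The default value 0 of
    [nth] is not positive, so indices past the end need no separate hypothesis. *)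
Lemma sorted_nth_gt0 (l : seq R) k :
  sorted (fun a b : R => b <= a) l ->
  (0 < nth 0 l k) = (k < count (fun a => (0 < a)%R) l)%N.
Proof.
elim: l k => [|a l IHl] k /= sl; first by rewrite nth_nil ltxx ltn0.
have al : {in l, forall b, b <= a}.
  by apply/allP; apply: order_path_min sl => u v w /[swap] /le_trans; exact.
have [a_gt0|a_le0] := ltP 0 a.
  by case: k => [|k] //=; rewrite IHl // (path_sorted sl).
rewrite (_ : count _ l = 0%N) ?addn0 ?ltn0; last first.
  by apply/eqP; rewrite -leqn0 leqNgt -has_count; apply/hasPn => b /al ba; rewrite -leNgt (le_trans ba).
apply/negbTE; rewrite -leNgt; case: k => [|k] //=.
have [kl|kl] := ltnP k (size l); last by rewrite nth_default.
by rewrite (le_trans _ a_le0) // al // mem_nth.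
Qed.

Lemma norm0_count x : norm0 x =
  count (fun a => (0 < a)%R)
    (sort (fun a b : R => b <= a) [seq `|x 0 i| | i <- enum 'I_n]).
Proof.
rewrite count_sort count_map -sum1_count /norm0 -sum1_card big_enum_cond /=.
by apply: eq_bigl => i; rewrite inE normr_gt0.
Qed.

Lemma sorted_abs x :
  sorted (fun a b : R => b <= a)
    (sort (fun a b : R => b <= a) [seq `|x 0 i| | i <- enum 'I_n]).
Proof. by apply: sort_sorted => a b; exact: le_total. Qed.

Lemma abs_nth_largest_gt0 x s : (0 < s)%N -> norm0 x = s ->
  0 < abs_nth_largest s x.
Proof.
move=> s_gt0 xs; rewrite sorted_nth_gt0 ?sorted_abs // -norm0_count xs.
by rewrite prednK.
Qed.

(** A nonzero entry sits among the first [s] places of the sorted list, hence no later than the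
    place [s.-1]. *)
Lemma abs_nth_largest_le x s i : (0 < s)%N -> norm0 x = s -> i \in supp x ->
  abs_nth_largest s x <= `|x 0 i|.
Proof.
move=> s_gt0 xs; rewrite inE => xi.
set l := sort (fun a b : R => b <= a) [seq `|x 0 i| | i <- enum 'I_n].
have : `|x 0 i| \in l 
  by rewrite mem_sort; apply/mapP; exists i; rewrite ?mem_enum.
case/(nthP 0) => k kl k_nth; rewrite -k_nth.
have : 0 < nth 0 l k by rewrite k_nth normr_gt0.
rewrite sorted_nth_gt0 ?sorted_abs // -norm0_count xs => ks.
have sz : (s <= size l)%N by rewrite -xs norm0_count count_size.
apply: (sorted_leq_nth (leT := fun a b : R => b <= a)) => //.
- by move=> u v w /[swap] /le_trans; exact.
- exact: sorted_abs.
- by rewrite inE prednK.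
- by rewrite -ltnS prednK.
Qed.

End AbsNthLargest.

(** * Projection onto the sparse vectors *)

Section Projection.
Variables (R : realType) (n : nat).
Implicit Types x q w z : 'rV[R]_n.

Lemma norm2_sqr z : norm2 z ^+ 2 = \sum_i z 0 i ^+ 2.
Proof.
rewrite sqr_sqrtr; first by apply: eq_bigr => i _; rewrite expr2.
by apply: sumr_ge0 => i _; rewrite -expr2 sqr_ge0.
Qed.

Lemma norm2_sqr0 : norm2 (0 : 'rV[R]_n) ^+ 2 = 0.
Proof. by rewrite norm2_sqr big1 // => i _; rewrite mxE expr0n. Qed.

Lemma norm2_eq0 z : norm2 z ^+ 2 = 0 -> z = 0.
Proof.
rewrite norm2_sqr => z0; apply/rowP => i; rewrite mxE; apply/eqP.
by rewrite -sqrf_eq0; apply/eqP/(psumr_eq0P _ z0) => // j _; exact: sqr_ge0.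
Qed.

Lemma suppN x i : i \notin supp x -> x 0 i = 0.
Proof. by rewrite inE negbK => /eqP. Qed.

Lemma sparse_proj_id s x : sparse s x -> sparse_proj s x = [set x]%classic.
Proof.
move=> sx; apply/seteqP; split => [w [_ /(_ x sx)]|_ ->].
  rewrite subrr norm2_sqr0 => w_le; have /norm2_eq0/eqP : norm2 (x - w) ^+ 2 = 0.
    by apply/eqP; rewrite eq_le w_le sqr_ge0.
  by rewrite subr_eq0 => /eqP.
by split=> // v _; rewrite subrr norm2_sqr0 sqr_ge0.
Qed.

(** Changing an entry inside the support keeps the vector sparse, and that entry's contribution to
    the distance can be cancelled; minimality says it was already zero. *)
Lemma sparse_proj_supp0 s x q b i : b != 0 -> sparse_proj s (x - b *: q) x ->
  i \in supp x -> q 0 i = 0.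
Proof.
move=> b_neq0 [sx x_min] xi.
(* With this step [w] agrees with [x - b *: q] at the entry [i]. *)
pose t := - (b * q 0 i).
pose w : 'rV[R]_n := x + t *: delta_mx 0 i.
have sw : sparse s w.
  apply: leq_trans sx; apply/subset_leq_card/fintype.subsetP => j.
  rewrite [in X in X -> _]inE !mxE eqxx /=; have [->//|_] := eqVneq j i.
  by rewrite mulr0 addr0 inE.
have := x_min _ sw; rewrite !norm2_sqr (bigD1 i) //= [leRHS](bigD1 i) //=.
rewrite (eq_bigr (fun j => (x - b *: q - w) 0 j ^+ 2)); last first.
  by move=> j ji; rewrite !mxE (negPf ji) andbF mulr0 addr0.
rewrite lerD2r !mxE !eqxx mulr1 /t => le_sq.
have /eqP : (b * q 0 i) ^+ 2 = 0.
  apply/eqP; rewrite eq_le sqr_ge0 andbT (le_trans _ (le_trans le_sq _)) //.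
    by rewrite le_eqVlt; apply/orP; left; apply/eqP; ring.
  by rewrite le_eqVlt; apply/orP; left; apply/eqP; ring.
by rewrite sqrf_eq0 mulf_eq0 (negPf b_neq0) => /eqP.
Qed.

(* The threshold [th] turns the cardinality bound on [w] into a price paid per
   nonzero entry, so that the comparison can be made entry by entry. *)
Lemma sparse_proj_threshold s x q b th :
    norm0 x = s -> (forall i, i \in supp x -> q 0 i = 0) ->
    (forall i, i \in supp x -> th < x 0 i ^+ 2) ->
    (forall i, i \notin supp x -> (b * q 0 i) ^+ 2 < th) -> 0 <= th ->
  sparse_proj s (x - b *: q) = [set x]%classic.
Proof.
move=> xs q0 x_gt q_lt th_ge0.
have sx : sparse s x by rewrite /sparse /= xs.
(* [D w i] is the contribution of the entry [i] to the excess of [w] over [x] in squared distance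
   plus [th] times the number of nonzero entries. *)
pose D w i := (x - b *: q - w) 0 i ^+ 2 - (x - b *: q - x) 0 i ^+ 2
  + th * (i \in supp w)%:R - th * (i \in supp x)%:R.
(* Three cases: modifying a nonzero entry of [x] costs a positive square, deleting it costs
   [x 0 i ^+ 2 - th], and creating a new entry costs at least [th - (b * q 0 i) ^+ 2]. *)
have D_gt0 w i : w 0 i != x 0 i -> 0 < D w i.
  move=> wx; rewrite /D !mxE.
  have [xi|xi] := boolP (i \in supp x).
    rewrite q0 // !mulr0 mulr1; have [wi|wi] := boolP (i \in supp w).
      have : 0 < (x 0 i - w 0 i) ^+ 2 by rewrite exprn_even_gt0 //= subr_eq0 eq_sym.
      by rewrite mulr1; nra.
    by rewrite (suppN wi) mulr0; have := x_gt i xi; nra.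
  rewrite (suppN xi) mulr0 in wx *.
  have wi : i \in supp w by rewrite inE.
  by rewrite wi mulr1; have := q_lt i xi; have := sqr_ge0 (b * q 0 i + w 0 i); nra.
have D_ge0 w i : 0 <= D w i.
  have [wx|/D_gt0/ltW//] := eqVneq (w 0 i) (x 0 i).
  have wi : (i \in supp w) = (i \in supp x) by rewrite !inE wx.
  by rewrite /D wi !mxE wx; lra.
have sumD w : \sum_i D w i = norm2 (x - b *: q - w) ^+ 2
    - norm2 (x - b *: q - x) ^+ 2 + th * (norm0 w)%:R - th * (norm0 x)%:R.
  have cardE (A : {set 'I_n}) : #|A|%:R = \sum_i (i \in A)%:R :> R.
    by rewrite -sum1_card natr_sum big_mkcond; apply: eq_bigr => i _; case: ifP.
  rewrite !norm2_sqr /norm0 !cardE !mulr_sumr -!sumrN -!big_split /=.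
  exact: eq_bigr.
have le_sum w : sparse s w ->
    \sum_i D w i <= norm2 (x - b *: q - w) ^+ 2 - norm2 (x - b *: q - x) ^+ 2.
  rewrite /sparse /= -(ler_nat R) sumD xs => ws.
  by have := ler_wpM2l th_ge0 ws; lra.
apply/seteqP; split => [w [sw /(_ x sx) w_min]|_ ->]; last first.
  split=> // w /le_sum; have := @sumr_ge0 R _ (index_enum _) predT (D w) (fun i _ => D_ge0 w i).
  by lra.
(* Another minimizer has total excess at most 0 although every term is nonnegative, so all terms
   vanish and strictness forces [w = x]. *)
have D0 : \sum_i D w i = 0.
  apply/eqP; rewrite eq_le sumr_ge0 // andbT (le_trans (le_sum w sw)) //.
  by rewrite subr_le0.
apply/rowP => i; apply/eqP; apply: contraT => /D_gt0.
by rewrite (psumr_eq0P _ D0) ?ltxx.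
Qed.

End Projection.

(** * Jacobian, gradient of the Lagrangian, and column submatrices *)

Section Components.
Variables (R : realType) (n m : nat) (h : 'rV[R]_n -> 'rV[R]_m).
Hypothesis dh : forall k x, differentiable (fun z => h z 0 k) x.

(** Smoothness is assumed of the components of [h], whereas the Jacobian calls for the differential
    of [h] itself; expanding in the canonical basis links the two. *)
Lemma differentiable_rV x : differentiable h x.
Proof.
rewrite (_ : h = fun z => \sum_(k < m) h z 0 k *: delta_mx 0 k); last first.
  by apply/funext => z; exact: row_sum_delta.
by apply: differentiable_bigsum => k; exact: differentiableZl.
Qed.

Lemma jacobian_gradients x :
  jacobian_mx h x = gradients (fun k z => h z 0 k) x.
Proof.
have dhx := differentiable_rV x.
apply/matrixP => k i; rewrite !mxE.
have := deriveEjacobian (delta_mx 0 i) dhx.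
rewrite derive_mx; last exact: diff_derivable.
by move/rowP/(_ k); rewrite -rowE !mxE.
Qed.

Lemma grad_lagrangianE (f : 'rV[R]_n -> R) x y : differentiable f x ->
  grad_lagrangian f h x y
  = gradient f x - y *m gradients (fun k z => h z 0 k) x.
Proof.
move=> df; apply/rowP => i; rewrite !mxE.
have dterm k : differentiable (fun z => y 0 k * h z 0 k) x by exact: differentiableZ.
rewrite (_ : (fun z => _) = f - (fun z => \sum_(k < m) y 0 k * h z 0 k)) //.
have dsum := differentiable_bigsum dterm.
rewrite deriveB; [|exact: diff_derivable..].
rewrite derive_bigsum //; congr (_ - _); apply: eq_bigr => k _.
rewrite !mxE -[LHS]/('D_(delta_mx 0 i) (y 0 k *: (fun z => h z 0 k)) x).
by rewrite deriveZ //; exact: diff_derivable.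
Qed.

End Components.

Section Subcols.
Variables (R : realType) (n : nat).

Lemma subcols_rinv p (T : {set 'I_n}) (A : 'M[R]_(p, n)) :
  \rank (subcols T A) = p ->
  exists2 P : 'M[R]_(n, p), A *m P = 1%:M & forall i k, i \notin T -> P i k = 0.
Proof.
move=> rkA; have /row_freeP[B AB1] : row_free (subcols T A) by exact/eqP.
(* The selected columns of the identity embed the coordinates of [T] into the whole space: [B] is
   padded with zero rows off [T]. *)
exists (colsub (fun k : 'I_#|T| => enum_val k) 1%:M *m B).
  by rewrite mulmxA mulmx_colsub mulmx1.
move=> i k iT; rewrite mxE big1 // => j _; rewrite !mxE.
have /negPf-> : i != enum_val j by apply: contraNneq iT => ->; exact: enum_valP.
by rewrite mul0r.
Qed.

Lemma subcols_norm (T : {set 'I_n}) (q : 'rV[R]_n) i :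
  i \in T -> `|q 0 i| <= `|subcols T q|.
Proof.
move=> iT; have -> : q 0 i = subcols T q 0 (enum_rank_in iT i).
  by rewrite mxE enum_rankK_in.
rewrite [leRHS]/Num.Def.normr/= mx_normrE.
exact: (le_bigmax _ (fun j : 'I_1 * 'I_#|T| => `|subcols T q j.1 j.2|) (0, enum_rank_in iT i)).
Qed.

End Subcols.

(** * The bound on beta and sufficient conditions for strong stationarity *)

Section BetaHat.
Variables (R : realType) (n m s : nat).
Variables (f : 'rV[R]_n -> R) (h : 'rV[R]_n -> 'rV[R]_m).

(** Serves uniqueness: the range of admissible beta is never empty, so stationarity over that range
    is not vacuous. *)
Lemma beta_hat_gt0 x y : (0 < s)%N ->
  exists2 b : R, 0 < b & (b%:E < beta_hat f h s x y)%E.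
Proof.
move=> s_gt0; rewrite /beta_hat; case: ifP => [/andP[/eqP xs q_neq0]|_]; last first.
  by exists 1 => //; rewrite ltry.
set b := _ / _; have b_gt0 : 0 < b.
  by rewrite divr_gt0 ?normr_gt0 // abs_nth_largest_gt0.
by exists (b / 2); rewrite ?lte_fin; lra.
Qed.

(** If [q = 0], a sparse point is projected onto itself. Otherwise the support has exactly [s]
    elements and [q] is nonzero off it, so the bound is finite and says that each entry of [b *: q]
    off the support is smaller in absolute value than each nonzero entry of [x]. *)
Lemma strong_stationaryP x y (q := grad_lagrangian f h x y) b :
    (0 < s)%N -> sparse s x -> h x = 0 ->
    (forall i, i \in supp x -> q 0 i = 0) -> ((norm0 x < s)%N -> q = 0) ->
    0 < b -> (b%:E < beta_hat f h s x y)%E ->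
  strong_stationary f h s b x y.
Proof.
move=> s_gt0 sx hx q_supp q0 b_gt0 b_lt; split=> //; rewrite -/q.
have [q_eq0|q_neq0] := eqVneq q 0; first by rewrite q_eq0 scaler0 subr0 sparse_proj_id.
have xs : norm0 x = s.
  by apply/eqP; rewrite eqn_leq [X in X && _]sx leqNgt; apply: contra_neqN q_neq0 => /q0.
move: b_lt; rewrite /beta_hat -/q xs eqxx /=.
set Q := subcols _ q; have [Q0 _|Q_neq0] := eqVneq Q 0.
  suff qz : q = 0 by rewrite qz eqxx in q_neq0.
  apply/rowP => i; rewrite [RHS]mxE.
  have [/q_supp//|xi] := boolP (i \in supp x).
  apply/eqP; rewrite -normr_le0 -[leRHS](normr0 'rV[R]_#|(~: supp x)%SET|) -Q0.
  by apply: subcols_norm; rewrite inE.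
rewrite /= lte_fin ltr_pdivlMr ?normr_gt0 //.
have := abs_nth_largest_le s_gt0 xs; set a := abs_nth_largest s x => a_le bQ_lt.
have bQ_ge0 : 0 <= b * `|Q| by rewrite mulr_ge0 // ltW.
have sq_lt : (b * `|Q|) ^+ 2 < a ^+ 2.
  by rewrite ltr_pXn2r ?nnegrE // ltW // (le_lt_trans bQ_ge0).
(* The threshold is the midpoint of the two squares compared in [sq_lt]. *)
apply: (@sparse_proj_threshold _ _ _ _ _ _ (((b * `|Q|) ^+ 2 + a ^+ 2) / 2)) => //.
- move=> i /a_le a_le_xi; have : a ^+ 2 <= x 0 i ^+ 2.
    rewrite -[leRHS]real_normK ?num_real // lerXn2r ?nnegrE //.
    by rewrite ltW // (le_lt_trans bQ_ge0).
  by lra.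
- move=> i xi; have : (b * q 0 i) ^+ 2 <= (b * `|Q|) ^+ 2.
    rewrite !exprMn ler_wpM2l ?sqr_ge0 // -real_normK ?num_real //.
    by rewrite lerXn2r ?nnegrE // subcols_norm // inE.
  by lra.
- by rewrite divr_ge0 // addr_ge0 // sqr_ge0.
Qed.

End BetaHat.

(** * Existence and uniqueness of the multiplier *)

Theorem theorem2p4 (R : realType) (n m s : nat)
    (n_gt0 : (0 < n)%N) (m_gt0 : (0 < m)%N) (s_gt0 : (0 < s)%N) (s_lt_n : (s < n)%N)
    (f : 'rV[R]_n -> R) (h : 'rV[R]_n -> 'rV[R]_m)
    (f_C2 : twice_continuously_differentiable f)
    (h_C2 : forall i : 'I_m, twice_continuously_differentiable (fun x => h x 0 i))
    (xs : 'rV[R]_n) (xs_min : local_minimizer f (feasible h s) xs)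
    (rank_xs : \rank (subcols (supp xs) (jacobian_mx h xs)) = m) :
  exists! ys : 'rV[R]_m,
    forall beta : R, 0 < beta -> (beta%:E < beta_hat f h s xs ys)%E ->
      strong_stationary f h s beta xs ys.
Proof.
have df x : differentiable f x by case: f_C2.
have dh k x : differentiable (fun z => h z 0 k) x by case: (h_C2 k).
have cgf : continuous (gradient f).
  by move=> x; apply: differentiable_continuous; case: f_C2 => _ [].
have cgh k : continuous (gradient (fun z => h z 0 k)).
  by move=> x; apply: differentiable_continuous; case: (h_C2 k) => _ [].
have [[hxs sxs] f_min] := xs_min.
pose A := gradients (fun k z => h z 0 k) xs.
have [P AP1 P0] : exists2 P : 'M[R]_(n, m), A *m P = 1%:M
    & forall i k, i \notin supp xs -> P i k = 0.
  by apply: subcols_rinv; rewrite /A -jacobian_gradients.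
pose ys := gradient f xs *m P.
(* All points supported in such a [T] are sparse, so [xs] is also a local minimizer under that
   linear constraint; [ys] is the same for every [T]. *)
have q_eq0 (T : {set 'I_n}) i : supp xs \subset T -> (#|T| <= s)%N -> i \in T ->
    grad_lagrangian f h xs ys 0 i = 0.
  move=> xsT Ts iT; rewrite grad_lagrangianE // [LHS]mxE [X in _ + X]mxE.
  apply/eqP; rewrite subr_eq0; apply/eqP.
  apply: (lagrange_multiplier df dh cgf cgh xsT) => //.
  - by move=> k; rewrite hxs mxE.
  - apply: filterS f_min => z z_min zT hz; apply: z_min; split.
      by apply/rowP => k; rewrite hz mxE.
    exact: leq_trans (subset_leq_card zT) Ts.
  - by move=> j k jT; apply: P0; apply: contraNN jT; exact: (fintype.subsetP xsT).
exists ys; split.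
  move=> b b_gt0 b_lt; apply: strong_stationaryP => // [i|xs_lt].
    exact: q_eq0.
  (* When the support has fewer than [s] elements, any index can be added to it. *)
  apply/rowP => i; rewrite [RHS]mxE; apply: (q_eq0 (i |: supp xs)%SET).
  - exact: finset.subsetUr.
  - by rewrite cardsU1 (leq_trans _ xs_lt) // -add1n leq_add2r leq_b1.
  - exact: setU11.
move=> y y_stat; have [b b_gt0 b_lt] := beta_hat_gt0 f h xs y s_gt0.
have [proj_eq _] := y_stat b b_gt0 b_lt.
have xs_proj : sparse_proj s (xs - b *: grad_lagrangian f h xs y) xs by rewrite proj_eq.
have b_neq0 : b != 0 by rewrite gt_eqF.
(* Since [y = y *m A *m P] and [P] vanishes off the support, it is enough to compare the gradient of
   [f] with [y *m A] on the support, where stationarity for the single value [b] gives equality. *)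
rewrite /ys -[RHS]mulmx1 -AP1 mulmxA; apply/rowP => k; rewrite !mxE.
apply: eq_bigr => i _; have [xi|/P0->] := boolP (i \in supp xs); last by rewrite !mulr0.
have := sparse_proj_supp0 b_neq0 xs_proj xi.
rewrite grad_lagrangianE // [LHS]mxE [X in _ + X]mxE => /eqP.
by rewrite subr_eq0 => /eqP ->.
Qed.
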